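(* Let $G$ be a connected finite simple graph with vertex set $\{0,1,\dots,n\}$, let $\{k_1,k_2\}\in E(G)$, let $C$ be a cell in the edge contraction subdivision $\mathcal{D}_{k_1,k_2}$ of $\nabla_G$, and let $X$ be a nonempty subset of $C$ that contains either both of the points $\pm(\mathbf{e}_{k_1}-\mathbf{e}_{k_2})$ or none of them. Then: (i) $X$ is affinely independent if and only if $G_X$ is a forest. (ii) $X$ is a circuit if and only if $G_X$ is a chordless cycle. (iii) $\dim(X)=|V(G_X)|+|E(G_X)\cap\{\{k_1,k_2\}\}|-m-1$, where $m$ is the number of connected components of $G_X$. (iv) $\operatorname{corank}(X)$ equals the cyclomatic number of $G_X$.
   Context: For a connected finite simple graph $G$ with vertex set $\{0,1,\dots,n\}$ and edge set $E(G)$, let $\mathbf{e}_1,\dots,\mathbf{e}_n$ be the standard basis of $\mathbb{R}^n$ and $\mathbf{e}_0=\mathbf{0}$. Put $A_G=\{\mathbf{e}_i-\mathbf{e}_j : \{i,j\}\in E(G)\}$ (both orientations of every edge are included). The adjacency polytope is $\nabla_G=\operatorname{conv}(A_G)\subset\mathbb{R}^n$. Edge contraction subdivision: for an edge $\{k_1,k_2\}\in E(G)$, let $\omega:A_G\to\mathbb{Z}$ be given by $\omega(\mathbf{e}_i-\mathbf{e}_j)=0$ if $\{i,j\}=\{k_1,k_2\}$ and $\omega(\mathbf{e}_i-\mathbf{e}_j)=1$ otherwise. $\mathcal{D}_{k_1,k_2}$ is the regular subdivision of $\nabla_G$ (as a subdivision of the point configuration $A_G$) induced by $\omega$: its cells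 are the subsets $C\subseteq A_G$ with $\dim\operatorname{conv}(C)=n$ for which there exist $\boldsymbol\alpha\in\mathbb{R}^n$ and $h\in\mathbb{R}$ with $\langle\mathbf{x},\boldsymbol\alpha\rangle+\omega(\mathbf{x})=h$ for all $\mathbf{x}\in C$ and $\langle\mathbf{x},\boldsymbol\alpha\rangle+\omega(\mathbf{x})>h$ for all $\mathbf{x}\in A_G\setminus C$. For nonempty $X\subseteq A_G$, $G_X$ is the undirected simple graph with edge set $\{\{i,j\}:\mathbf{e}_i-\mathbf{e}_j\in X\text{ or }\mathbf{e}_j-\mathbf{e}_i\in X\}$, whose vertex set $V(G_X)$ consists of the endpoints of these edges. ''$G_X$ is a chordless cycle'' refers to the graph $G_X$ itself: the whole graph $G_X$ is a cycle (chords are considered within $G_X$, not in $G$). For a finite point set $X$: $\dim X$ is the dimension of its affine span; $X$ is a circuit if it is affinely dependent but every proper subset is affinely independent; $\operatorname{corank}(X)=|X|-\dim X-1$. The cyclomatic number of a graph is the dimension of its cycle space over $\mathbb{Z}_2$, i.e. the minimum number of edges whose removal leaves a spanning forest. *)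

(* Defs.v *)
From mathcomp Require Import all_boot all_order all_algebra finmap.
From mathcomp Require Import boolp classical_sets reals.

Set Implicit Arguments.
Unset Strict Implicit.
Unset Printing Implicit Defensive.

Import Order.TTheory GRing.Theory Num.Theory.
Local Open Scope ring_scope.

Section AffineGeometry.
Variables (R : realType) (n : nat).
Implicit Types (S : set 'rV[R]_n) (X Y A C : {fset 'rV[R]_n}).

Definition dot (x y : 'rV[R]_n) : R := \sum_i x 0 i * y 0 i.

Definition affine_span S : set 'rV[R]_n :=
  [set x | exists (F : {fset 'rV[R]_n}) (c : 'rV[R]_n -> R),
     [/\ (forall p, p \in F -> S p),
         \sum_(p <- F) c p = 1
       & x = \sum_(p <- F) c p *: p]]%classic.

Definition conv S : set 'rV[R]_n :=
  [set x | exists (F : {fset 'rV[R]_n}) (c : 'rV[R]_n -> R),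
     [/\ (forall p, p \in F -> S p),
         (forall p, p \in F -> 0 <= c p),
         \sum_(p <- F) c p = 1
       & x = \sum_(p <- F) c p *: p]]%classic.

(* L is the translate of a linear subspace of dimension d. *)
Definition is_affine_of_dim (L : set 'rV[R]_n) (d : nat) : Prop :=
  exists (x : 'rV[R]_n) (D : {vspace 'rV[R]_n}),
    L = [set x + v | v in [set v | v \in D]]%classic /\ \dim D = d.

(* The dimension of the affine span; the default value makes the empty set
   have dimension -1. *)
Definition adim S : int :=
  xget (-1) [set z | exists2 d : nat,
                       is_affine_of_dim (affine_span S) d & z = d%:Z]%classic.

Definition affinely_independent X : Prop :=
  forall c : 'rV[R]_n -> R,
    \sum_(p <- X) c p = 0 -> \sum_(p <- X) c p *: p = 0 ->
    forall p, p \in X -> c p = 0.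

Definition circuit X : Prop :=
  ~ affinely_independent X /\
  forall Y, (Y `<` X)%fset -> affinely_independent Y.

Definition corank X : int := #|` X|%:Z - adim [set` X] - 1.

(* C is a (full-dimensional) cell of the regular subdivision of the point
   configuration A induced by the height function omega. *)
Definition regular_cell A (omega : 'rV[R]_n -> int) C : Prop :=
  [/\ (C `<=` A)%fset,
      adim (conv [set` C]) = n%:Z
    & exists (alpha : 'rV[R]_n) (h : R),
        (forall x, x \in C -> dot x alpha + (omega x)%:~R = h) /\
        (forall x, x \in A -> x \notin C -> dot x alpha + (omega x)%:~R > h)].

End AffineGeometry.

(* A graph on a finite type T is given by its symmetric adjacency relation r.
   [verts r] collects the endpoints of edges only: T may contain further
   elements, which are not regarded as vertices of the graph. *)
Section Graphs.
Variables (T : finType) (r : rel T).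

Definition verts : {set T} := [set i | [exists j, r i j || r j i]].

Definition edges : {set {set T}} :=
  [set [set p.1; p.2] | p in [pred p : T * T | r p.1 p.2]].

Definition forest : Prop := ~ exists p : seq T, (2 < size p)%N /\ ucycle r p.

(* The whole edge set is that of the cycle, so there is no chord. *)
Definition chordless_cycle : Prop :=
  exists p : seq T,
    [/\ (2 < size p)%N, ucycle r p & edges = [set [set i; next p i] | i in p]].

Definition ncomponents : nat := n_comp r verts.

Definition incidence : 'M['F_2]_(#|edges|, #|T|) :=
  \matrix_(k < #|edges|, v < #|T|) (enum_val v \in enum_val k)%:R.

(* The cycle space over Z/2: a row vector u with u *m incidence = 0 is the
   indicator of a set of edges in which every vertex has even degree. *)
Definition cyclomatic_number : nat := \rank (kermx incidence).

End Graphs.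

Section AdjacencyPolytope.
Variables (R : realType) (n : nat).

(* vec 0 is the origin and vec i, for 1 <= i <= n, the i-th standard basis
   vector; coordinates are numbered from 0 in 'rV[R]_n. *)
Definition vec (i : 'I_n.+1) : 'rV[R]_n :=
  if unlift ord0 i is Some k then delta_mx 0 k else 0.

Definition adj_points (G : rel 'I_n.+1) : {fset 'rV[R]_n} :=
  [fset vec p.1 - vec p.2 | p in [pred p : 'I_n.+1 * 'I_n.+1 | G p.1 p.2]]%fset.

(* The points vec i - vec j with i != j are pairwise distinct, so the pair
   {i, j} is {k1, k2} exactly when the point is one of the two below. *)
Definition contraction_height (k1 k2 : 'I_n.+1) (x : 'rV[R]_n) : int :=
  if (x == vec k1 - vec k2) || (x == vec k2 - vec k1) then 0 else 1.

Definition contraction_cell (G : rel 'I_n.+1) (k1 k2 : 'I_n.+1)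
    (C : {fset 'rV[R]_n}) : Prop :=
  regular_cell (adj_points G) (contraction_height k1 k2) C.

Definition point_graph (X : {fset 'rV[R]_n}) : rel 'I_n.+1 :=
  fun i j => (vec i - vec j \in X) || (vec j - vec i \in X).

End AdjacencyPolytope.

(* Main.v *)
Require Import Defs.
From mathcomp Require Import all_boot all_order all_algebra finmap.
From mathcomp Require Import boolp classical_sets reals.
From mathcomp Require Import zify ring.
Import Order.TTheory GRing.Theory Num.Theory.
Local Open Scope ring_scope.
Set Implicit Arguments.
Unset Strict Implicit.
Unset Printing Implicit Defensive.

(** Write u for e_k1 - e_k2 and let (alpha, h) be the functional and the height
    that cut out the cell C.  Both u and -u lie in the configuration at height
    0, so h <= <u, alpha> and h <= - <u, alpha>, whence h <= 0.  Every other
    point x of C has height 1 and satisfies <x, alpha> = h - 1 < 0.  So X never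
    contains two opposite points, except possibly u and -u: apart from these, X
    is an orientation of the graph G_X.

    Applying alpha to a linear relation sum_x c_x x = 0 on X determines
    sum_x c_x.  If X avoids both u and -u, then (h - 1) sum_x c_x = 0, so the
    relation is automatically affine.  If X contains both, then h = 0, and the
    relation is affine exactly when c_u + c_{-u} = 0.  Both facts are recorded in
    [oriented_off] and proved in [cell_oriented_off].

    It follows that the affine dependencies c of X correspond to the
    circulations g of G_X (antisymmetric functions on its arcs with zero
    divergence) by g i j = c (e_i - e_j) - c (e_j - e_i), a pair of opposite
    coefficients on u and -u giving the value on the edge k1 k2
    ([dependency_circulation], [circulation_dependency]).  Zeros of c on X are
    zeros of g on edges, so affine independence of X and its being a circuit
    become properties of the circulations of G_X.  A graph is a forest iff its
    only circulation is 0: a cycle carries a unit flow, while in a forest each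
    edge is a bridge, and the flow through the cut that it forms vanishes
    ([forestP]).  A graph is a single cycle iff it has a nonzero circulation and
    none of those vanishes on an edge ([chordless_cycleP]); circuits have the
    same description in terms of dependencies ([circuitP]).

    For the dimension and the corank, the differences w_i - w_j along the edges
    of a graph span a space of dimension |V| - m whenever the w_i are affinely
    free, over any field ([dim_span_edges]).  Over R this is the dimension of the linear
    span of X; the affine span of X is this whole space when it contains u and
    -u, hence 0, and a hyperplane of it missing 0 otherwise.  Over F_2 it is the
    rank of the incidence matrix.  Finally |X| is the number of edges of G_X,
    plus 1 when both u and -u are in X. *)

(** * Auxiliary facts on sums and unordered pairs *)

Lemma sum_seq1 (V : zmodType) (I : eqType) (s : seq I) (i : I) (f : I -> V) :
  uniq s -> i \in s -> (forall j, j != i -> f j = 0) -> \sum_(j <- s) f j = f i.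
Proof.
move=> sU si f0; rewrite (bigD1_seq i) //= big1_seq ?addr0 //.
by move=> j /andP[/f0].
Qed.

Lemma sum_delta (F : pzRingType) (T : finType) (i : T) : \sum_j (i == j)%:R = 1 :> F.
Proof.
by rewrite (@big_only1 _ _ _ _ i) ?eqxx // => j /negbTE; rewrite eq_sym => ->.
Qed.

Lemma sum_deltaZ (F : pzRingType) (V : lmodType F) (T : finType) (w : T -> V) i :
  \sum_j (i == j)%:R *: w j = w i.
Proof.
rewrite (@big_only1 _ _ _ _ i) ?eqxx ?scale1r // => j /negbTE; rewrite eq_sym => ->.
by rewrite scale0r.
Qed.

Lemma set2_eqP (T : finType) (x y i j : T) :
  reflect ((x = i /\ y = j) \/ (x = j /\ y = i)) ([set x; y] == [set i; j]).
Proof.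
apply: (iffP eqP) => [/setP E|[[-> ->]|[-> ->]]] //; last by rewrite finset.setUC.
move: (E x) (E y) (E i) (E j); rewrite !inE !eqxx /= ?orbT => /esym /orP xE /esym /orP yE.
case: xE => /eqP ->; case: yE => /eqP ->; rewrite ?orbb; auto.
- by move=> _ /eqP ->; left.
- by move=> /eqP -> _; left.
Qed.

(** * Circulations on a graph *)

Section Circulations.
Variables (F : numFieldType) (T : finType).
Implicit Types (r : rel T) (g : T -> T -> F) (p : seq T).

Definition circulation r g : Prop :=
  [/\ forall i j, g j i = - g i j,
      forall i j, ~~ r i j -> g i j = 0
    & forall i, \sum_j g i j = 0].

(** The flow inside S cancels by antisymmetry, so the total divergence of S is
    the flow out of S. *)
Lemma circulation_cut r g (S : {set T}) :
  circulation r g -> \sum_(i in S) \sum_(j | j \notin S) g i j = 0.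
Proof.
move=> [ganti _ gcons].
have S0 : \sum_(i in S) \sum_(j in S) g i j = 0.
  apply/eqP; rewrite -eqNr -sumrN [X in _ == X]exchange_big /=; apply/eqP.
  by apply: eq_bigr => i _; rewrite -sumrN; apply: eq_bigr => j _; rewrite -ganti.
transitivity (\sum_(i in S) \sum_j g i j); last by rewrite big1.
rewrite -[LHS]add0r -{1}S0 -big_split /=; apply: eq_bigr => i _.
by rewrite [RHS](bigID (mem S)).
Qed.

(** A simple path from i to j avoiding the edge i j has at least two steps, so
    it closes up to a cycle. *)
Lemma forest_bridge r i j : symmetric r -> irreflexive r -> forest r -> r i j ->
  ~~ connect [rel x y | r x y && ([set x; y] != [set i; j])] i j.
Proof.
move=> rsym rirr rF rij; apply/negP => /connectP[p0 p0P lastp0].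
case/shortenP: p0P lastp0 => p pP pU _ lastp; apply: rF.
exists (i :: p); split.
  case: p pP lastp {pU} => [|x [|y p]] //=; first by move=> _ E; rewrite -E rirr in rij.
  by move=> + E; rewrite -E eqxx andbF.
rewrite /ucycle pU andbT /= rcons_path -lastp rsym rij andbT.
by apply: sub_path pP => x y /andP[].
Qed.

(** Let S be the component of i after deleting the edge i j.  Only that edge
    leaves S, so the flow out of S is g i j. *)
Lemma forest_circulation0 r g : symmetric r -> irreflexive r -> forest r ->
  circulation r g -> forall i j, g i j = 0.
Proof.
move=> rsym rirr rF gC i j; have [_ gsupp _] := gC.
have [rij|/gsupp//] := boolP (r i j).
set e := [rel x y | r x y && ([set x; y] != [set i; j])].
have eNij : ~~ connect e i j by exact: forest_bridge.
have := circulation_cut [set x | connect e i x] gC.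
have ii : i \in [set x | connect e i x] by rewrite inE connect0.
rewrite (bigD1 i) //= (bigD1 j) ?inE //=.
have out x y : connect e i x -> ~~ connect e i y -> (x, y) != (i, j) -> g x y = 0.
  move=> ix iNy xy; apply: gsupp; apply: contra (iNy) => rxy.
  apply: connect_trans ix (connect1 _); rewrite /= rxy /=.
  apply: contra xy => /set2_eqP[[-> ->]|[_ E]] //.
  by rewrite E connect0 in iNy.
rewrite [X in _ + X + _]big1 ?addr0; last first.
  move=> y /andP[]; rewrite inE => yN yj; apply: out => //.
  by rewrite xpair_eqE eqxx.
rewrite [X in _ + X]big1 ?addr0 // => x /andP[]; rewrite inE => xS xi.
apply: big1 => y; rewrite inE => yS; apply: out => //.
by rewrite xpair_eqE (negbTE xi).
Qed.

Lemma next_next p i : uniq p -> (2 < size p)%N -> i \in p -> next p (next p i) != i.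
Proof.
move=> pU p2 ip; have [k q E] := rot_to ip.
have qU : uniq (i :: q) by rewrite -E rot_uniq.
have : (2 < size (i :: q))%N by rewrite -E size_rot.
rewrite -!(next_rot k pU) E.
case: q {E} qU => [|a [|b q]] //=; rewrite !inE !negb_or => /and3P[/and3P[ia ib iq] /andP[ab aq] _] _.
by rewrite eqxx [a == i]eq_sym (negbTE ia) eqxx eq_sym.
Qed.

(** The unit flow around the cycle p. *)
Definition cycle_circulation p (i j : T) : F :=
  ((i \in p) && (j == next p i))%:R - ((j \in p) && (i == next p j))%:R.

Lemma cycle_circulationP r p : symmetric r -> ucycle r p ->
  circulation r (cycle_circulation p).
Proof.
move=> rsym /andP[pC pU]; split=> [i j|i j rN|i].
- by rewrite /cycle_circulation opprB.
- rewrite /cycle_circulation.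
  case: andP => [[ip /eqP E]|_]; first by rewrite E next_cycle in rN.
  case: andP => [[jp /eqP E]|_]; last by rewrite subr0.
  by rewrite rsym E next_cycle in rN.
- rewrite sumrB (bigD1 (next p i)) //= eqxx andbT big1 ?addr0; last first.
    by move=> j /negbTE ->; rewrite andbF.
  rewrite (bigD1 (prev p i)) //= big1 ?addr0; last first.
    by move=> j; case: andP => // -[jp /eqP ->]; rewrite prev_next ?eqxx.
  by rewrite next_prev // eqxx andbT mem_prev subrr.
Qed.

Lemma cycle_circulation_next p i : uniq p -> (2 < size p)%N -> i \in p ->
  cycle_circulation p i (next p i) = 1.
Proof.
move=> pU p2 ip; rewrite /cycle_circulation ip eqxx mem_next ip /=.
by rewrite eq_sym (negbTE (next_next _ _ _)) // subr0.
Qed.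

Lemma forestP r : symmetric r -> irreflexive r ->
  forest r <-> forall g, circulation r g -> forall i j, g i j = 0.
Proof.
move=> rsym rirr; split=> [rF g gC i j|g0 [p [p2 pC]]].
  exact: (forest_circulation0 rsym rirr rF gC).
have [_ pU] := andP pC.
case: p p2 pC pU => // i p p2 pC pU.
have /eqP := g0 _ (cycle_circulationP rsym pC) i (next (i :: p) i).
by rewrite cycle_circulation_next ?mem_head // oner_eq0.
Qed.

Lemma mem_edges r i j : symmetric r -> ([set i; j] \in edges r) = r i j.
Proof.
move=> rsym; apply/imsetP/idP => [[[x y]]|rij]; last by exists (i, j).
by rewrite inE /= => xy /eqP/set2_eqP[[-> ->]|[-> ->]] //; rewrite rsym.
Qed.

Section ChordlessCycle.
Variables (r : rel T) (p : seq T).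
Hypotheses (rsym : symmetric r) (pU : uniq p) (p2 : (2 < size p)%N)
           (rE : edges r = [set [set i; next p i] | i in p]).

Lemma cycle_edgeP i j : reflect (i \in p /\ (j = next p i \/ j = prev p i)) (r i j).
Proof.
rewrite -mem_edges // rE; apply: (iffP imsetP) => [[x xp]|[ip [->|->]]].
- move=> /eqP/set2_eqP[[-> ->]|[-> ->]]; first by split => //; left.
  by rewrite mem_next prev_next //; split => //; right.
- by exists i.
- by exists (prev p i); rewrite ?mem_prev // next_prev // finset.setUC.
Qed.

(** The vertex j = next p i has no neighbours other than i and next p j, so what
    flows in from i must flow out to next p j. *)
Lemma circulation_next g i : circulation r g ->
  g (next p i) (next p (next p i)) = g i (next p i).
Proof.
move=> [ganti gsupp gcons].
have [ip|ip] := boolP (i \in p); last first.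
  (* next p fixes the vertices outside p *)
  by have E : next p i = i; [rewrite next_nth (negbTE ip) | rewrite !E].
set j := next p i; have jp : j \in p by rewrite mem_next.
have := gcons j; rewrite (bigD1 (next p j)) //= (bigD1 i) /=; last first.
  by rewrite eq_sym next_next.
rewrite big1 => [|x /andP[xj xi]].
  by rewrite addr0 (ganti i j) => /eqP; rewrite subr_eq0 => /eqP.
apply: gsupp; apply/cycle_edgeP => -[_ [xE|xE]]; first by rewrite xE eqxx in xj.
by rewrite xE prev_next ?eqxx in xi.
Qed.

Lemma circulation_cycle_eq0 g i j : circulation r g -> r i j -> g i j = 0 ->
  forall x y, g x y = 0.
Proof.
move=> gC; have [ganti gsupp gcons] := gC.
have gpos x y : x \in p -> y \in p -> g x (next p x) = g y (next p y).
  move=> xp yp; apply: (@fconnect_invariant _ (next p) _ (fun z => g z (next p z))).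
    by move=> z; apply/eqP; exact: circulation_next.
  by rewrite (fconnect_cycle (cycle_next pU)).
have gprev x : g x (prev p x) = - g (prev p x) (next p (prev p x)).
  by rewrite next_prev // -ganti.
move=> /cycle_edgeP[ip ijE] g0 x y.
have gi0 : g i (next p i) = 0.
  case: ijE g0 => -> // /eqP; rewrite gprev oppr_eq0 => /eqP <-.
  by apply: gpos; rewrite ?mem_prev.
have [/cycle_edgeP[xp [->|->]]|/gsupp//] := boolP (r x y).
  by rewrite (gpos x i).
by rewrite gprev (gpos _ i) ?mem_prev // gi0 oppr0.
Qed.

End ChordlessCycle.

(** In the converse direction a nonzero circulation yields a cycle p of r, and
    the unit flow around p can vanish on no edge of r, so r has no edge off p. *)
Lemma chordless_cycleP r : symmetric r -> irreflexive r ->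
  chordless_cycle r <->
  (exists2 g, circulation r g & exists i j, g i j != 0) /\
  (forall g i j, circulation r g -> r i j -> g i j = 0 -> forall x y, g x y = 0).
Proof.
move=> rsym rirr; split=> [[p [p2 pC rE]]|[[g gC [i [j gij]]] gall]].
  have [_ pU] := andP pC; split; last first.
    by move=> g i j; exact: (circulation_cycle_eq0 rsym pU p2 rE).
  have /hasP[i ip _] : has predT p by rewrite has_predT (ltn_trans _ p2).
  exists (cycle_circulation p); first exact: cycle_circulationP.
  by exists i, (next p i); rewrite cycle_circulation_next // oner_eq0.
have /contrapT[p [p2 pC]] : ~ forest r.
  by move=> rF; rewrite (forest_circulation0 rsym rirr rF gC) eqxx in gij.
have [pcyc pU] := andP pC; exists p; split=> //.
have cC := cycle_circulationP rsym pC.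
apply/setP => e; apply/idP/imsetP => [|[x xp ->]]; last first.
  by rewrite mem_edges // next_cycle.
case/imsetP => -[x y] /=; rewrite inE /= => rxy ->.
have [c0|] := eqVneq (cycle_circulation p x y) 0.
  have /hasP[z zp _] : has predT p by rewrite has_predT (ltn_trans _ p2).
  have /eqP := gall _ _ _ cC rxy c0 z (next p z).
  by rewrite cycle_circulation_next // oner_eq0.
rewrite /cycle_circulation.
case: andP => [[xp /eqP ->] _|_]; first by exists x.
case: andP => [[yp /eqP ->] _|_]; first by exists y => //; rewrite finset.setUC.
by rewrite subrr eqxx.
Qed.

End Circulations.

(** * The span of the edges of a graph *)

Section SpanOfEdges.
Variables (F : fieldType) (V : vectType F) (T : finType).

Definition affinely_free (w : T -> V) : Prop :=
  forall c : T -> F, \sum_i c i = 0 -> \sum_i c i *: w i = 0 ->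
  forall i, c i = 0.

Variables (w : T -> V) (r : rel T).
Hypotheses (wfree : affinely_free w) (rsym : symmetric r).

(* One vector per vertex other than the chosen roots of the components, joining
   the vertex to its root: a basis of the span of the edges. *)
Let nonroots := [tuple w (enum_val k) - w (fingraph.root r (enum_val k))
                | k < #|[predC fingraph.roots r]|].

Lemma free_nonroots : free nonroots.
Proof.
apply/freeP => c c0 k0.
(* d collects the coefficients by vertex; no nonroot is a root, so d agrees
   with c there. *)
pose d j : F := \sum_k c k * ((enum_val k == j)%:R - (fingraph.root r (enum_val k) == j)%:R).
have d0 j : d j = 0.
  apply: wfree.
    rewrite exchange_big big1 //= => k _.
    by rewrite -mulr_sumr sumrB !sum_delta subrr mulr0.
  rewrite -[RHS]c0; under eq_bigr do rewrite scaler_suml.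
  rewrite exchange_big; apply: eq_bigr => k _.
  rewrite nth_mktuple -[in RHS](sum_deltaZ w (enum_val k)).
  rewrite -(sum_deltaZ w (fingraph.root r _)) -sumrB scaler_sumr.
  by apply: eq_bigr => j' _; rewrite -scalerBl scalerA.
rewrite -(d0 (enum_val k0)) /d (bigD1 k0) //= eqxx.
have nroot k : (fingraph.root r (enum_val k) == enum_val k0) = false.
  apply: contraTF (enum_valP k0) => /eqP <-.
  by rewrite inE /= negbK; apply: roots_root; exact: sym_connect_sym.
rewrite nroot subr0 mulr1 big1 ?addr0 // => k kk0.
by rewrite nroot (inj_eq enum_val_inj) (negbTE kk0) subr0 mulr0.
Qed.

(** The span contains w i - w j for i and j in the same component, by
    telescoping along a path.  So it has a basis with one vector per vertex that
    is not the root of its component, and isolated points of T are roots. *)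
Lemma dim_span_edges (s : seq V) :
  (forall v, v \in s -> exists i j, r i j /\ v = w i - w j) ->
  (forall i j, r i j -> w i - w j \in <<s>>%VS) ->
  (\dim <<s>> + n_comp r (verts r) = #|verts r|)%N.
Proof.
move=> s_edge edge_s; have csym := sym_connect_sym rsym.
have toroot i : w i - w (fingraph.root r i) \in <<nonroots>>%VS.
  have [/eqP ->|iN] := boolP (fingraph.roots r i); first by rewrite subrr mem0v.
  have iA : i \in [predC fingraph.roots r] by [].
  apply: memv_span; apply/mapP; exists (enum_rank_in iA i); rewrite ?mem_enum //.
  by rewrite enum_rankK_in.
have connect_s i j : connect r i j -> w i - w j \in <<s>>%VS.
  case/connectP => p; elim: p i => /= [|k p IHp] i; first by move=> _ ->; rewrite subrr mem0v.
  case/andP => rik pP lastp.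
  rewrite -[w i](subrK (w k)) -addrA.
  by apply: memvD; [exact: edge_s | exact: IHp].
have -> : <<s>>%VS = <<nonroots>>%VS.
  apply/eqP; rewrite eqEsubv; apply/andP; split; apply/span_subvP => v.
    case/s_edge => i [j [rij ->]].
    have E : fingraph.root r i = fingraph.root r j by apply/(fingraph.rootP csym)/connect1.
    have -> : w i - w j = (w i - w (fingraph.root r i)) - (w j - w (fingraph.root r j)).
      by rewrite E opprB addrA subrK.
    by rewrite memvB.
  by case/mapP => k _ ->; apply: connect_s; exact: fingraph.connect_root.
rewrite (eqP free_nonroots) size_tuple.
rewrite -(cardID (fingraph.roots r) (verts r)) addnC; congr (_ + _)%N.
  by apply: eq_card => x; rewrite !inE andbC.
apply: eq_card => x; rewrite !inE /=; apply/idP/andP => [xN|[]//]; split=> //.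
have /connectP[[|y p] /= xp lastp] := fingraph.connect_root r x.
  by rewrite /fingraph.roots /= lastp eqxx in xN.
by apply/existsP; exists y; case/andP: xp => ->.
Qed.

End SpanOfEdges.

Section RowSpan.
Variables (F : fieldType) (n : nat).

Lemma submx_span m (u : 'rV[F]_n) (A : 'M[F]_(m, n)) :
  (u <= A)%MS -> u \in <<[tuple row k A | k < m]>>%VS.
Proof.
case/submxP => D ->; rewrite mulmx_sum_row; apply: memv_suml => k _.
by apply/memvZ/memv_span/mapP; exists k; rewrite ?mem_enum.
Qed.

Lemma dim_span_rows m (A : 'M[F]_(m, n)) :
  \dim <<[tuple row k A | k < m]>> = \rank A.
Proof.
have -> : <<[tuple row k A | k < m]>>%VS = <<[tuple row k (row_base A) | k < \rank A]>>%VS.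
  apply/eqP; rewrite eqEsubv; apply/andP; split; apply/span_subvP => _ /mapP[k _ ->].
    by apply: submx_span; rewrite eq_row_base row_sub.
  by apply: submx_span; rewrite (submx_trans (row_sub _ _)) ?eq_row_base.
suff /eqP -> : free [tuple row k (row_base A) | k < \rank A] by rewrite size_tuple.
apply/freeP => c c0 k.
have /(row_free_inj (row_base_free A)) : (\row_j c j) *m row_base A = 0 *m row_base A.
  rewrite mul0mx mulmx_sum_row -[RHS]c0; apply: eq_bigr => j _.
  by rewrite mxE -tnth_nth tnth_mktuple.
by move/matrixP/(_ 0 k); rewrite !mxE.
Qed.

End RowSpan.

(** Over F_2 the incidence row of the edge i j is also w i - w j, for w the
    standard basis, so [dim_span_edges] gives the rank of the incidence matrix. *)
Lemma cyclomatic_numberE (T : finType) (r : rel T) : symmetric r -> irreflexive r ->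
  (cyclomatic_number r + #|verts r| = #|edges r| + ncomponents r)%N.
Proof.
move=> rsym rirr; rewrite /cyclomatic_number mxrank_ker.
pose w (i : T) : 'rV['F_2]_#|T| := delta_mx 0 (enum_rank i).
have w_free : affinely_free w.
  move=> c _ /rowP cw i; have := cw (enum_rank i).
  rewrite summxE mxE => <-; rewrite (bigD1 i) //= !mxE !eqxx mulr1.
  rewrite big1 ?addr0 // => j ji; rewrite !mxE eqxx /= (inj_eq enum_rank_inj).
  by rewrite eq_sym (negbTE ji) mulr0.
have rowE k i j : r i j -> enum_val k = [set i; j] -> row k (incidence r) = w i - w j.
  move=> rij kE; apply/rowP => v; rewrite !mxE eqxx /= kE !inE.
  rewrite -{3 4}[v]enum_valK !(inj_eq enum_rank_inj).
  have [->|vi] := eqVneq; last by case: eqP => _; rewrite ?subr0 //; apply/eqP.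
  by case: eqVneq rij => [->|_ _]; rewrite ?rirr // subr0.
have E := dim_span_edges w_free rsym (s := [tuple row k (incidence r) | k < #|edges r|]).
rewrite dim_span_rows in E; rewrite -E /ncomponents.
- by rewrite addnA subnK // rank_leq_row.
- move=> v /mapP[k _ ->]; have /imsetP[[i j] /=] := enum_valP k.
  by rewrite inE /= => rij kE; exists i, j; split=> //; exact: rowE.
- move=> i j rij; apply: memv_span; apply/mapP.
  have eij : [set i; j] \in edges r by rewrite mem_edges.
  exists (enum_rank_in eij [set i; j]); first by rewrite mem_enum.
  by rewrite (rowE _ i j) // enum_rankK_in.
Qed.

(** * Affine dimension and dependencies of a finite point set *)

Section AffineHull.
Variables (R : realType) (n : nat).
Implicit Types (X Y : {fset 'rV[R]_n}) (c : 'rV[R]_n -> R).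

Lemma adimE (S : set 'rV[R]_n) d :
  is_affine_of_dim (affine_span S) d -> adim S = d%:Z.
Proof.
move=> Sd; apply: xget_unique => [|_ [d' Sd' ->]]; first by exists d.
case: Sd Sd' => x [D [-> <-]] [x' [D' [E <-]]]; congr (\dim _)%:Z.
have sub y (U U' : {vspace 'rV[R]_n}) y' :
    [set y + v | v in [set v | v \in U]]%classic
    = [set y' + v | v in [set v | v \in U']]%classic -> (U <= U')%VS.
  move=> EU; apply/subvP => v vU.
  have [a aU' ya] : [set y' + v | v in [set v | v \in U']]%classic (y + v).
    by rewrite -EU; exists v.
  have [b bU' yb] : [set y' + v | v in [set v | v \in U']]%classic y.
    by rewrite -EU; exists 0; rewrite ?addr0 //= mem0v.
  have -> : v = a - b by rewrite -(addKr y v) -ya -{1}yb opprD addrACA addNr add0r addrC.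
  exact: memvB.
by apply: subv_anti; rewrite (sub _ _ _ _ E) (sub _ _ _ _ (esym E)).
Qed.

Lemma mem_span_map (s : seq 'rV[R]_n) (f : 'rV[R]_n -> 'rV[R]_n) v : uniq s ->
  v \in <<map f s>>%VS -> exists c, v = \sum_(x <- s) c x *: f x.
Proof.
elim: s v => [|y s IHs] v /=.
  by move=> _; rewrite span_nil memv0 => /eqP ->; exists (fun=> 0); rewrite big_nil.
case/andP => ys sU; rewrite span_cons => /memv_addP[_ /vlineP[k ->] [b bs ->]].
have [c ->] := IHs _ sU bs; exists (fun x => if x == y then k else c x).
rewrite big_cons eqxx; congr (_ + _); apply: eq_big_seq => x xs.
by case: eqP xs ys => // -> ->.
Qed.

Lemma affine_span_fset X x0 : x0 \in X ->
  affine_span [set` X]%classic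
  = [set x0 + v | v in [set v | v \in <<[seq (x - x0)%R | x <- X]>>%VS]]%classic.
Proof.
move=> x0X; apply/seteqP; split=> y.
  move=> [A [c [AX c1 ->]]]; exists (\sum_(p <- A) c p *: (p - x0)) => /=.
    rewrite big_seq; apply: memv_suml => p /AX pX; apply/memvZ/memv_span.
    exact: map_f.
  under eq_bigr do rewrite scalerBr.
  by rewrite sumrB -scaler_suml c1 scale1r addrC subrK.
move=> [v /= /(mem_span_map (fset_uniq X))[c ->] <-].
(* correct the coefficient of x0 so that the coefficients add up to 1 *)
pose c' x := c x + (1 - \sum_(p <- X) c p) * (x == x0)%:R.
exists X, c'; split=> //.
  rewrite big_split -mulr_sumr /= [X in _ + _ * X](sum_seq1 (fset_uniq X) x0X) => [|x /negbTE -> //].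
  by rewrite eqxx mulr1 addrC subrK.
rewrite /c'; under [RHS]eq_bigr do rewrite scalerDl.
rewrite big_split /= [X in _ = _ + X](sum_seq1 (fset_uniq X) x0X) => [|x /negbTE ->]; last first.
  by rewrite mulr0 scale0r.
under eq_bigr do rewrite scalerBr.
rewrite eqxx mulr1 sumrB -scaler_suml scalerBl scale1r.
by rewrite addrCA.
Qed.

Lemma adim_fset X x0 : x0 \in X ->
  adim [set` X]%classic = (\dim <<[seq (x - x0)%R | x <- X]>>%VS)%:Z.
Proof.
move=> x0X; apply: adimE; rewrite (affine_span_fset x0X).
by exists x0, <<[seq (x - x0)%R | x <- X]>>%VS.
Qed.

Definition affine_dependency X c : Prop :=
  \sum_(x <- X) c x = 0 /\ \sum_(x <- X) c x *: x = 0.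

(** A dependency of X vanishing at x is one of X minus x; a dependency of a
    proper subset Y extends by 0 to X and vanishes off Y. *)
Lemma circuitP X : circuit X <->
  (exists2 c, affine_dependency X c & exists2 x, x \in X & c x != 0) /\
  (forall c x, affine_dependency X c -> x \in X -> c x = 0 ->
     forall y, y \in X -> c y = 0).
Proof.
split=> [[Xdep Xmin]|[[c [c1 c0] [x xX cx]] call]]; split.
- apply: contrapT => noc; apply: Xdep => c c1 c0 x xX.
  by apply: contrapT => /eqP cx; apply: noc; exists c => //; exists x.
- move=> c x [c1 c0] xX cx y yX.
  have [->//|yx] := eqVneq y x.
  have YX : (X `\ x `<` X)%fset by rewrite fproperD1.
  have E (V : zmodType) (f : 'rV[R]_n -> V) : f x = 0 ->
      \sum_(z <- (X `\ x)%fset) f z = \sum_(z <- X) f z.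
    by move=> fx; rewrite [RHS](big_fsetD1 x) //= fx add0r.
  apply: (Xmin _ YX c); rewrite ?E ?cx ?scale0r //.
  by rewrite !inE yx.
- by move=> /(_ c c1 c0 x xX) /eqP; apply/negP.
- move=> Y /andP[YX /fsubsetPn[z zX zY]] d d1 d0 y yY.
  pose d' u := if u \in Y then d u else 0.
  have E (V : zmodType) (f : 'rV[R]_n -> V) : (forall u, u \notin Y -> f u = 0) ->
      \sum_(u <- Y) f u = \sum_(u <- X) f u.
    by move=> f0; apply: big_fset_incl => // u _ /f0.
  have d'0 u : u \notin Y -> d' u = 0 by rewrite /d' => /negbTE ->.
  have d'Y u : u \in Y -> d' u = d u by rewrite /d' => ->.
  rewrite -(d'Y y yY); apply: (call _ z) => //; [|exact: d'0|exact: (fsubsetP YX)].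
  split.
    by rewrite -(E _ _ d'0) -[RHS]d1; apply: eq_big_seq => u /d'Y.
  rewrite -E => [|u /d'0 ->]; last by rewrite scale0r.
  by rewrite -[RHS]d0; apply: eq_big_seq => u /d'Y ->.
Qed.

End AffineHull.

(** * Differences of affinely free vectors *)

Section EdgeVectors.
Variables (F : numFieldType) (V : vectType F) (T : finType) (w : T -> V).
Hypothesis wfree : affinely_free w.

Lemma edge_vector_inj i j k l : i != j -> w i - w j = w k - w l -> (i, j) = (k, l).
Proof.
move=> ij E.
pose c x : F := (i == x)%:R - (j == x)%:R - ((k == x)%:R - (l == x)%:R).
have c0 x : c x = 0.
  apply: wfree; first by rewrite !sumrB !sum_delta !subrr.
  under eq_bigr do rewrite !scalerBl.
  by rewrite !sumrB !sum_deltaZ E subrr.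
have := c0 i; rewrite /c eqxx eq_sym (negbTE ij) => ci.
have := c0 j; rewrite /c eqxx (negbTE ij) => cj.
have ik : i = k.
  apply/eqP; rewrite eq_sym; apply: contraPT ci => /negbTE ->; rewrite subr0 sub0r opprK.
  by apply/eqP; rewrite gt_eqF // ltr_wpDr.
have jl : j = l.
  apply/eqP; rewrite eq_sym; apply: contraPT cj => /negbTE ->; rewrite subr0 sub0r.
  by apply/eqP; rewrite -opprD oppr_eq0 gt_eqF // ltr_wpDr.
by rewrite ik jl.
Qed.

(** The coefficient of w i is the divergence at i of the flow induced by a. *)
Lemma divergence_sum (a : T -> T -> F) :
  \sum_i (\sum_j (a i j - a j i)) *: w i = \sum_i \sum_j a i j *: (w i - w j).
Proof.
under eq_bigr do rewrite sumrB scalerBl !scaler_suml.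
rewrite sumrB [X in _ - X]exchange_big -sumrB; apply: eq_bigr => i _ /=.
by rewrite -sumrB; apply: eq_bigr => j _; rewrite scalerBr.
Qed.

End EdgeVectors.

Lemma vec_free (R : realType) n : affinely_free (@vec R n).
Proof.
move=> c c1 c0.
have cl k : c (lift ord0 k) = 0.
  have := congr1 (fun v : 'rV[R]_n => v 0 k) c0.
  rewrite summxE big_ord_recl /vec unlift_none scaler0 !mxE add0r => <-.
  rewrite (bigD1 k) //= liftK !mxE !eqxx mulr1 big1 ?addr0 // => l lk.
  by rewrite liftK !mxE eqxx /= eq_sym (negbTE lk) mulr0.
move=> i; have [k ->//|->] := unliftP ord0 i.
by move: c1; rewrite big_ord_recl big1 ?addr0.
Qed.

(** * Points oriented off one edge *)

Section Configuration.
Variables (R : realType) (n : nat) (k1 k2 : 'I_n.+1) (X : {fset 'rV[R]_n}).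
Implicit Types (c : 'rV[R]_n -> R) (g : 'I_n.+1 -> 'I_n.+1 -> R).

Let arc (i j : 'I_n.+1) := vec R i - vec R j.
Let r := point_graph X.

(** X is an orientation of its graph, up to the edge k1 k2, which has both
    orientations or none.  The last clause is what the functional alpha of a cell
    leaves behind: it reduces the affine condition on a linear relation to the
    two points of that edge. *)
Definition oriented_off : Prop :=
  [/\ forall x, x \in X -> exists i j, i != j /\ x = vec R i - vec R j,
      forall i j, vec R i - vec R j \in X -> vec R j - vec R i \in X ->
        [set i; j] = [set k1; k2],
      (vec R k1 - vec R k2 \in X) = (vec R k2 - vec R k1 \in X)
    & forall c, \sum_(x <- X) c x *: x = 0 ->
        \sum_(x <- X) c x =
          if vec R k1 - vec R k2 \in X
          then c (vec R k1 - vec R k2) + c (vec R k2 - vec R k1) else 0].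

Hypothesis Xoriented : oriented_off.

Let arcs : {set 'I_n.+1 * 'I_n.+1} := [set q | arc q.1 q.2 \in X].

Lemma point_arc x : x \in X -> exists i j, x = arc i j /\ arc i j \in X.
Proof.
have [Xarc _ _ _] := Xoriented; move=> xX; have [i [j [_ xE]]] := Xarc _ xX.
by exists i, j; rewrite /arc -xE.
Qed.

Lemma arc_neq i j : arc i j \in X -> i != j.
Proof.
have [Xarc _ _ _] := Xoriented; move=> /Xarc[a [b [ab E]]].
by have [<- <-] := edge_vector_inj (@vec_free R n) ab (esym E).
Qed.

Lemma point_graph_sym : symmetric r.
Proof. by move=> i j; rewrite /r /point_graph orbC. Qed.

Lemma point_graph_irr : irreflexive r.
Proof.
move=> i; rewrite /r /point_graph orbb; apply/negP => /arc_neq.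
by rewrite eqxx.
Qed.

Lemma perm_arcs : perm_eq X [seq arc q.1 q.2 | q <- enum arcs].
Proof.
apply: uniq_perm; rewrite ?fset_uniq //.
  rewrite map_inj_in_uniq ?enum_uniq // => -[a b] [i j] /=.
  rewrite !mem_enum inE /= => /arc_neq ab _.
  exact: (edge_vector_inj (@vec_free R n)).
move=> x; apply/idP/mapP => [xX|[q]]; last by rewrite mem_enum inE => ? ->.
have [i [j [-> ijX]]] := point_arc xX.
by exists (i, j); rewrite ?mem_enum ?inE.
Qed.

Lemma sum_arcs (V : zmodType) (f : 'rV[R]_n -> V) :
  \sum_(x <- X) f x = \sum_i \sum_j (if arc i j \in X then f (arc i j) else 0).
Proof.
rewrite (perm_big _ perm_arcs) big_map big_enum big_mkcond pair_big /=.
by apply: eq_bigr => q _; rewrite inE.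
Qed.

(** On the edge k1 k2 the coefficients of a dependency are opposite, so their
    difference is twice the first one and has the same zeros. *)
Lemma dependency_circulation c : affine_dependency X c ->
  exists2 g : 'I_n.+1 -> 'I_n.+1 -> R, circulation r g
    & forall i j, arc i j \in X -> (g i j == 0) = (c (arc i j) == 0).
Proof.
move=> [c1 c0]; have [_ two_way _ sumX] := Xoriented.
pose a i j : R := if arc i j \in X then c (arc i j) else 0.
exists (fun i j => a i j - a j i); first split=> [i j|i j|].
- by rewrite opprB.
- by rewrite /r /point_graph /a => /norP[/negbTE -> /negbTE ->]; rewrite subr0.
- apply: (@vec_free R n).
    by under eq_bigr do rewrite sumrB; rewrite sumrB [X in _ - X]exchange_big subrr.
  rewrite divergence_sum -[RHS]c0 sum_arcs.
  apply: eq_bigr => i _; apply: eq_bigr => j _.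
  by rewrite /a; case: ifP => // _; rewrite scale0r.
move=> i j ij; rewrite /a ij; case: ifP => [ji|_]; last by rewrite subr0.
have := sumX _ c0; rewrite c1.
have cN : c (arc i j) + c (arc j i) = 0 ->
    (c (arc i j) - c (arc j i) == 0) = (c (arc i j) == 0).
  move=> /eqP; rewrite addr_eq0 => /eqP ->.
  by rewrite -opprD oppr_eq0 -mulr2n mulrn_eq0 oppr_eq0.
have /eqP/set2_eqP[[iE jE]|[iE jE]] := two_way _ _ ij ji; rewrite -iE -jE.
  by rewrite ij => /esym /cN.
by rewrite ji addrC => /esym /cN.
Qed.

(** The value of g on an edge is split equally among the orientations of that
    edge present in X. *)
Lemma circulation_dependency g : circulation r g ->
  exists2 c, affine_dependency X c
    & forall i j, arc i j \in X -> (c (arc i j) == 0) = (g i j == 0).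
Proof.
move=> [ganti gsupp gcons]; have [_ _ k12 sumX] := Xoriented.
pose a i j : R := g i j / (1 + (arc j i \in X)%:R).
pose c x := \sum_(q in arcs | arc q.1 q.2 == x) a q.1 q.2.
have wpos i j : 1 + (arc j i \in X)%:R != 0 :> R by rewrite gt_eqF // ltr_wpDr.
have cE i j : arc i j \in X -> c (arc i j) = a i j.
  move=> ij; rewrite /c (big_pred1 (i, j)) // => -[x y] /=; rewrite inE /=.
  apply/andP/eqP => [[xy /eqP]|[-> ->]] //.
  exact: (edge_vector_inj (@vec_free R n) (arc_neq xy)).
have c0 : \sum_(x <- X) c x *: x = 0.
  pose b i j := if arc i j \in X then a i j else 0.
  transitivity (\sum_i \sum_j b i j *: (vec R i - vec R j)).
    rewrite sum_arcs; apply: eq_bigr => i _; apply: eq_bigr => j _.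
    by rewrite /b; case: ifP => [/cE ->//|]; rewrite scale0r.
  rewrite -divergence_sum big1 // => i _.
  rewrite [X in X *: _](_ : _ = \sum_j g i j).
    by rewrite gcons scale0r.
  apply: eq_bigr => j _; rewrite /b /a.
  have := gsupp i j; have := ganti i j; rewrite /r /point_graph -/(arc i j) -/(arc j i).
  case: (arc i j \in X); case: (arc j i \in X) => /= gji gij.
  - by rewrite gji mulNr opprK; exact/esym/splitr.
  - by rewrite addr0 divr1 subr0.
  - by rewrite gji addr0 divr1 sub0r opprK.
  - by rewrite gij // subrr.
exists c; last by move=> i j ij; rewrite cE // /a mulf_eq0 invr_eq0 (negbTE (wpos _ _)) orbF.
split=> //; rewrite sumX //; case: ifP => // k1X.
by rewrite !cE -?k12 // /a /arc -k12 k1X (ganti k1 k2) mulNr subrr.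
Qed.

Lemma circulation_arcs0 g : circulation r g ->
  (forall i j, arc i j \in X -> g i j = 0) -> forall i j, g i j = 0.
Proof.
move=> [ganti gsupp _] g0 i j; have [|/gsupp//] := boolP (r i j).
by case/orP => /g0 // gji; rewrite ganti gji oppr0.
Qed.

Lemma affinely_independent_forest : affinely_independent X <-> forest r.
Proof.
rewrite (forestP R point_graph_sym point_graph_irr); split=> [indep g gC|g0 c c1 c0 x xX].
  apply: circulation_arcs0 => // i j ij.
  have [c [c1 c0] cg] := circulation_dependency gC.
  by apply/eqP; rewrite -cg // (indep c).
have [g gC gc] := dependency_circulation (conj c1 c0).
by have [i [j [-> ij]]] := point_arc xX; apply/eqP; rewrite -gc // g0.
Qed.

Lemma circuit_chordless_cycle : circuit X <-> chordless_cycle r.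
Proof.
rewrite circuitP (chordless_cycleP R point_graph_sym point_graph_irr).
split=> [[[c cD [x xX cx]] call]|[[g gC [i [j gij]]] gall]]; split.
- have [g gC gc] := dependency_circulation cD; exists g => //.
  have [i [j [xE ij]]] := point_arc xX; exists i, j.
  by rewrite gc // -xE.
- move=> g i j gC ij gij; apply: circulation_arcs0 => // a b ab.
  have [c' cD' cg] := circulation_dependency gC.
  have [ganti _ _] := gC.
  have [y yX cy] : exists2 y, y \in X & c' y = 0.
    case/orP: ij => ij; [exists (arc i j) | exists (arc j i)] => //; apply/eqP.
      by rewrite cg // gij.
    by rewrite cg // ganti gij oppr0.
  by apply/eqP; rewrite -cg // (call c' y).
- have [c cD cg] := circulation_dependency gC; exists c => //.
  apply: contrapT => Nc; case/eqP: gij; apply: circulation_arcs0 => // a b ab.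
  apply/eqP; rewrite -cg //; apply/negP => cab; apply: Nc.
  by exists (arc a b) => //; apply/negP.
- move=> c x cD xX cx y yX; have [f fC fc] := dependency_circulation cD.
  have [s [t [xE st]]] := point_arc xX; have [a [b [-> ab]]] := point_arc yX.
  apply/eqP; rewrite -fc //; apply/eqP; apply: (gall _ s t) => //.
    exact/orP/or_introl.
  by apply/eqP; rewrite fc // -xE cx.
Qed.

Lemma dim_span_points :
  (\dim <<X>> + ncomponents r = #|verts r|)%N.
Proof.
apply: (dim_span_edges (@vec_free R n) point_graph_sym) => [x xX|i j].
  have [i [j [xE ij]]] := point_arc xX; exists i, j; split=> //.
  exact/orP/or_introl.
case/orP => ijX; first exact: memv_span.
by rewrite -opprB memvN memv_span.
Qed.

(** Let D be the direction of the affine span, so that D and a base point x0 of X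
    generate the linear span.  Then x0 is in D iff 0 is in the affine span, iff
    X contains both points of the edge k1 k2. *)
Lemma adim_points : X != fset0 ->
  adim [set` X]%classic
  = #|verts r|%:Z + (arc k1 k2 \in X)%:Z - (ncomponents r)%:Z - 1.
Proof.
move=> /fset0Pn[y yX]; have [_ _ k12 sumX] := Xoriented.
(* with both points present, x0 is half the difference of x0 and its opposite *)
pose x0 := if arc k1 k2 \in X then arc k2 k1 else y.
have x0X : x0 \in X by rewrite /x0; case: ifP => //; rewrite k12.
rewrite (adim_fset x0X) -dim_span_points.
set D := <<[seq x - x0 | x <- X]>>%VS.
have memD x : x \in X -> x - x0 \in D by move=> xX; apply: memv_span; exact: map_f.
have XE : <<X>>%VS = (<[x0]> + D)%VS.
  apply/eqP; rewrite eqEsubv subv_add -memvE (memv_span x0X) /=; apply/andP; split.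
    apply/span_subvP => x xX; rewrite -[x](addrNK x0) addrC.
    by apply: memv_add; rewrite ?memv_line ?memD.
  by apply/span_subvP => _ /mapP[x xX ->]; rewrite memvB ?memv_span.
have x0D : (x0 \in D) = (arc k1 k2 \in X).
  have [k1X|k1X] := boolP (arc k1 k2 \in X).
    have -> : x0 = - 2^-1 *: (arc k1 k2 - x0).
      rewrite /x0 k1X /arc -(opprB (vec R k1)) opprK -mulr2n -scaler_nat scalerA.
      by rewrite mulNr mulVf ?pnatr_eq0 // scaleN1r.
    exact/memvZ/memD.
  apply/negP => /(mem_span_map (fset_uniq X))[c x0E].
  (* a linear relation on X with coefficient sum -1 *)
  pose d x := c x - (1 + \sum_(x <- X) c x) * (x == x0)%:R.
  have := sumX d; rewrite (negbTE k1X) sumrB -mulr_sumr.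
  rewrite [X in _ * X](sum_seq1 (fset_uniq X) x0X) => [|x /negbTE -> //].
  rewrite eqxx mulr1 opprD addrCA subrr addr0 => d0.
  have /eqP : -1 = 0 :> R; last by rewrite oppr_eq0 oner_eq0.
  apply: d0; under eq_bigr do rewrite scalerBl.
  rewrite sumrB [X in _ - X](sum_seq1 (fset_uniq X) x0X) => [|x /negbTE ->]; last first.
    by rewrite mulr0 scale0r.
  rewrite eqxx mulr1 scalerDl scale1r {1}x0E.
  under [X in _ - (X + _)]eq_bigr do rewrite scalerBr.
  by rewrite sumrB -scaler_suml subrK subrr.
have : (\dim <<X>> + (arc k1 k2 \in X) = (\dim D).+1)%N.
  rewrite -x0D XE; have [x0D'|x0D'] := boolP (x0 \in D).
    by rewrite (addv_idPr _) ?addn1.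
  rewrite addn0 dimv_disjoint_sum ?dim_vline; last first.
    apply/eqP; rewrite -dimv_eq0 -leqn0 -ltnS.
    have /leqifP := dimv_leqif_sup (capvSl <[x0]>%VS D).
    rewrite subv_cap subvv /= -memvE (negbTE x0D') dim_vline => H.
    by apply: leq_trans H _; case: (_ != _).
  by rewrite (_ : x0 != 0) //; apply: contraNneq x0D' => ->; exact: mem0v.
by clear; lia.
Qed.

(** Dropping the point k2 k1, if present, leaves one orientation of each edge. *)
Lemma card_points : #|` X| = (#|edges r| + (arc k1 k2 \in X))%N.
Proof.
have [_ two_way k12 _] := Xoriented.
rewrite (perm_size perm_arcs) size_map -cardE (cardsD1 (k2, k1)) addnC inE /=.
congr (_ + _)%N; last by rewrite /arc k12.
rewrite -(card_in_imset (f := fun q => [set q.1; q.2])) /=.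
  apply: eq_card => e; apply/imsetP/idP => [[[a b]]|].
    rewrite !inE /= => /andP[_ ab] ->; rewrite mem_edges; last exact: point_graph_sym.
    exact/orP/or_introl.
  have arc_im a b : arc a b \in X ->
      exists2 q, q \in arcs :\ (k2, k1) & [set a; b] = [set q.1; q.2].
    move=> abX; have [[aE bE]|abN] := eqVneq (a, b) (k2, k1); last first.
      by exists (a, b) => //; rewrite !inE abN.
    have k21 : k2 != k1 by rewrite -aE -bE; exact: arc_neq.
    exists (k1, k2); rewrite ?aE ?bE; last exact: finset.setUC.
    by rewrite !inE xpair_eqE (negbTE k21) andbF /= /arc k12 -aE -bE.
  case/imsetP => -[a b] /=; rewrite inE /= => /orP[] abX ->; first exact: arc_im.
  by rewrite finset.setUC; exact: arc_im.
move=> [a b] [c d]; rewrite !inE /= => /andP[abN abX] /andP[cdN cdX].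
move=> /eqP/set2_eqP[[-> ->]//|[aE bE]].
have dcX : arc d c \in X by rewrite -aE -bE.
have /eqP/set2_eqP[[dE cE]|[dE cE]] := two_way _ _ dcX cdX.
  by rewrite dE cE eqxx in cdN.
by rewrite aE bE dE cE eqxx in abN.
Qed.

End Configuration.

(** * Cells of the edge contraction subdivision *)

Section Cell.
Variables (R : realType) (n : nat).

Lemma dot_sum (s : seq 'rV[R]_n) (c : 'rV[R]_n -> R) a :
  dot (\sum_(x <- s) c x *: x) a = \sum_(x <- s) c x * dot x a.
Proof.
rewrite /dot; under eq_bigr do rewrite summxE mulr_suml.
rewrite exchange_big; apply: eq_bigr => x _ /=; rewrite mulr_sumr.
by apply: eq_bigr => i _; rewrite mxE mulrA.
Qed.

Lemma dotN (x a : 'rV[R]_n) : dot (- x) a = - dot x a.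
Proof. by rewrite /dot -sumrN; apply: eq_bigr => i _; rewrite mxE mulNr. Qed.

(** Two opposite points of height 1 in C would give h = 1, against h <= 0.  The
    coefficient sum of a linear relation on X is read off by pairing it with
    alpha. *)
Lemma cell_oriented_off (G : rel 'I_n.+1) (k1 k2 : 'I_n.+1) (C X : {fset 'rV[R]_n}) :
  symmetric G -> irreflexive G -> G k1 k2 -> contraction_cell G k1 k2 C ->
  (X `<=` C)%fset ->
  (vec R k1 - vec R k2 \in X) = (vec R k2 - vec R k1 \in X) ->
  oriented_off k1 k2 X.
Proof.
move=> Gsym Girr Gk [CA _ [a [h [heqC hltA]]]] XC k12.
pose u := vec R k1 - vec R k2; pose v := vec R k2 - vec R k1.
have vE : v = - u by rewrite opprB.
have Xarc x : x \in X -> exists i j, i != j /\ x = vec R i - vec R j.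
  move=> /(fsubsetP XC)/(fsubsetP CA)/imfsetP[[i j]] /= Gij ->; have {}Gij : G i j by [].
  by exists i, j; split=> //; apply: contraTneq Gij => ->; rewrite Girr.
have k1k2 : k1 != k2 by apply: contraTneq Gk => ->; rewrite Girr.
have uv : u != v.
  apply/eqP => /(edge_vector_inj (@vec_free R n) k1k2)[E _].
  by rewrite E eqxx in k1k2.
have wE x : (contraction_height k1 k2 x)%:~R = 1 - ((x == u)%:R + (x == v)%:R) :> R.
  rewrite /contraction_height -/u -/v.
  have [->|xu] := eqVneq x u; first by rewrite (negbTE uv) addr0 subrr.
  by case: (x == v); rewrite /= add0r ?subrr ?subr0.
have hE x : x \in X -> dot x a = h - 1 + ((x == u)%:R + (x == v)%:R).
  move=> /(fsubsetP XC) /heqC <-; rewrite wE.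
  by move: (dot x a) => d; ring.
have h_le x : x \in adj_points R G -> h <= dot x a + (contraction_height k1 k2 x)%:~R.
  by move=> xA; have [/heqC ->//|/(hltA _ xA)/ltW] := boolP (x \in C).
have h_le0 : h <= 0.
  have uA : u \in adj_points R G by apply/imfsetP; exists (k1, k2).
  have Gk' : G k2 k1 by rewrite Gsym.
  have vA : v \in adj_points R G by apply/imfsetP; exists (k2, k1).
  (* add the inequalities for the two opposite points u and v of height 0 *)
  have := lerD (h_le _ uA) (h_le _ vA); rewrite !wE !eqxx (negbTE uv) eq_sym (negbTE uv).
  by rewrite addr0 add0r subrr !addr0 vE dotN subrr; rewrite -mulr2n pmulrn_lle0.
have sum_pick (c : 'rV[R]_n -> R) x : \sum_(y <- X) c y * (y == x)%:R = if x \in X then c x else 0.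
  have [xX|xX] := ifPn.
    rewrite (sum_seq1 (fset_uniq X) xX) ?eqxx ?mulr1 // => y /negbTE ->.
    by rewrite mulr0.
  rewrite big1_seq // => y /andP[_ yX]; case: eqP => [E|]; last by rewrite mulr0.
  by rewrite -E yX in xX.
split=> // [i j ij ji|c c0].
  apply/eqP; apply: contraT => ijk.
  have ij0 : i != j.
    have [p [q [pq E]]] := Xarc _ ij.
    by have [<- <-] := edge_vector_inj (@vec_free R n) pq (esym E).
  have ijN k l : [set k; l] != [set i; j] -> (vec R i - vec R j == vec R k - vec R l) = false.
    move=> klij; apply: contraNF klij => /eqP/(edge_vector_inj (@vec_free R n) ij0).
    by case=> -> ->.
  have ijN' k l : [set k; l] != [set i; j] -> (vec R j - vec R i == vec R k - vec R l) = false.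
    by move=> klij; rewrite -[LHS]eqr_opp !opprB ijN // finset.setUC.
  have k12N : [set k1; k2] != [set i; j] by rewrite eq_sym.
  have k21N : [set k2; k1] != [set i; j] by rewrite finset.setUC.
  have dij : dot (vec R i - vec R j) a = h - 1 by rewrite hE // !ijN // !addr0.
  have : - dot (vec R i - vec R j) a = h - 1 by rewrite -dotN opprB hE // !ijN' // !addr0.
  move=> /eqP; rewrite dij eqNr subr_eq0 => /eqP h1.
  by rewrite h1 ler10 in h_le0.
rewrite -/u -/v.
have : 0 = \sum_(x <- X) c x * dot x a.
  rewrite -dot_sum c0 /dot big1 // => i _; by rewrite mxE mul0r.
under eq_big_seq => x xX do rewrite (hE _ xX) mulrDr (mulrDr _ (x == u)%:R).
rewrite !big_split /= -mulr_suml !sum_pick /= -[v \in X]k12 -/u.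
have [uX|uX] := boolP (u \in X); rewrite ?addr0 => E.
  have vX : v \in X by rewrite -k12.
  have du : dot u a = h by rewrite hE // eqxx (negbTE uv) addr0 subrK.
  have : - dot u a = h by rewrite -dotN -vE hE // eqxx eq_sym (negbTE uv) add0r subrK.
  move=> /eqP; rewrite du eqNr => /eqP h0; move: E; rewrite h0 sub0r mulrN1.
  by move/esym/eqP; rewrite addrC subr_eq0 => /eqP.
move/esym/eqP: E; rewrite mulf_eq0 => /orP[/eqP //|].
by rewrite subr_eq0 => /eqP h1; rewrite h1 ler10 in h_le0.
Qed.

End Cell.

(** * The correspondence between cells and graphs *)

Theorem theorem4 (R : realType) (n : nat) (G : rel 'I_n.+1)
    (Gsym : symmetric G) (Girr : irreflexive G)
    (Gconn : forall i j : 'I_n.+1, connect G i j)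
    (k1 k2 : 'I_n.+1) (Gk : G k1 k2)
    (C : {fset 'rV[R]_n}) (Ccell : contraction_cell G k1 k2 C)
    (X : {fset 'rV[R]_n}) (Xne : X != fset0) (XC : (X `<=` C)%fset)
    (Xk : (vec R k1 - vec R k2 \in X /\ vec R k2 - vec R k1 \in X) \/
          (vec R k1 - vec R k2 \notin X /\ vec R k2 - vec R k1 \notin X)) :
  [/\ affinely_independent X <-> forest (point_graph X),
      circuit X <-> chordless_cycle (point_graph X),
      adim [set` X]%classic =
        #|verts (point_graph X)|%:Z
        + #|edges (point_graph X) :&: [set [set k1; k2]]|%:Z
        - (ncomponents (point_graph X))%:Z - 1
    & corank X = (cyclomatic_number (point_graph X))%:Z].
Proof.
have k12 : (vec R k1 - vec R k2 \in X) = (vec R k2 - vec R k1 \in X).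
  by case: Xk => -[]; [move=> -> -> | move=> /negbTE -> /negbTE ->].
have Xoriented := cell_oriented_off Gsym Girr Gk Ccell XC k12.
have rsym := point_graph_sym X.
have Ecap : #|edges (point_graph X) :&: [set [set k1; k2]]|
            = (vec R k1 - vec R k2 \in X) :> nat.
  have <- : ([set k1; k2] \in edges (point_graph X)) = (vec R k1 - vec R k2 \in X).
    by rewrite mem_edges // /point_graph -k12 orbb.
  have [kE|kE] := boolP (_ \in edges _).
    by rewrite (finset.setIidPr _) ?cards1 ?finset.sub1set.
  by apply/eqP; rewrite cards_eq0 finset.setI_eq0 disjoint_sym disjoints1.
have Xdim := adim_points Xoriented Xne.
split.
- exact: affinely_independent_forest Xoriented.
- exact: circuit_chordless_cycle Xoriented.
- by rewrite Ecap.
- have := cyclomatic_numberE rsym (point_graph_irr Xoriented).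
  rewrite /corank Xdim (card_points Xoriented); clear; lia.
Qed.
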